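(* Let $G$ and $H$ be finite simple graphs with $\operatorname{im}(G)=t$ and $\operatorname{im}(H)=r$. Suppose there is a $K_t$-immersion $I_1$ in $G$ and a $K_r$-immersion $I_2$ in $H$ such that all of the paths between terminals in $I_1$ and in $I_2$ have the same parity (i.e., either every such path in both immersions has an even number of pegs, or every such path in both immersions has an odd number of pegs). Then $\operatorname{im}(G\times H)\geq (t-1)(r-1)+1$.
   Context: All graphs are finite and simple. A graph $G$ has a $G'$-immersion if there is an injective map $\phi:V(G')\to V(G)$ such that for every edge $uv\in E(G')$ there is a path $P_{u,v}$ in $G$ joining $\phi(u)$ and $\phi(v)$, and these paths are pairwise edge-disjoint. The vertices $\phi(v)$ are the terminals of the immersion, and the internal vertices of the paths $P_{u,v}$ are its pegs (so the number of pegs on a path is its length minus one). The immersion number $\operatorname{im}(G)$ is the largest $t$ such that $G$ has a $K_t$-immersion. The direct product $G\times H$ has vertex set $V(G)\times V(H)$, with $(g,h)$ adjacent to $(g',h')$ if and only if $gg'\in E(G)$ and $hh'\in E(H)$. *)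

(* Defs.v *)
From mathcomp Require Import all_boot.
From mathcomp Require Import boolp.

Set Implicit Arguments.
Unset Strict Implicit.
Unset Printing Implicit Defensive.

Record sgraph := SGraph {
  svertex :> finType;
  adj : rel svertex;
  adj_sym : symmetric adj;
  adj_irrefl : irreflexive adj
}.

Definition edges (G : sgraph) : {set {set G}} :=
  [set A : {set G} | [exists x, exists y, adj x y && (A == [set x; y])]].

Section Complete.
Variable t : nat.
Definition complete_rel : rel 'I_t := fun x y => x != y.
Lemma complete_sym : symmetric complete_rel.
Proof. by move=> x y; rewrite /complete_rel eq_sym. Qed.
Lemma complete_irrefl : irreflexive complete_rel.
Proof. by move=> x; rewrite /complete_rel eqxx. Qed.
Definition complete : sgraph := SGraph complete_sym complete_irrefl.
End Complete.

Section DirectProduct.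
Variables G H : sgraph.
Definition dprod_rel : rel (G * H)%type :=
  fun p q => adj p.1 q.1 && adj p.2 q.2.
Lemma dprod_sym : symmetric dprod_rel.
Proof. by move=> p q; rewrite /dprod_rel !(adj_sym p.1) !(adj_sym p.2). Qed.
Lemma dprod_irrefl : irreflexive dprod_rel.
Proof. by move=> p; rewrite /dprod_rel adj_irrefl. Qed.
Definition dprod : sgraph := SGraph dprod_sym dprod_irrefl.
End DirectProduct.

(* A path is given by the sequence of all its vertices, both ends included. *)
Definition is_path (G : sgraph) (x y : G) (s : seq G) : bool :=
  if s is z :: p then
    [&& z == x, path (@adj G) z p, last z p == y & uniq (z :: p)]
  else false.

Definition joins (G : sgraph) (x y : G) (s : seq G) : bool :=
  is_path x y s || is_path y x s.

Definition path_edges (G : sgraph) (s : seq G) : {set {set G}} :=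
  [set [set p.1; p.2] | p in zip s (behead s)].

Definition pegs (G : sgraph) (s : seq G) : seq G :=
  if s is x :: p then behead (belast x p) else [::].

(* Routes are indexed by unordered edges of F; the
   value of [route] on sets that are not edges of F is irrelevant. *)
Record immersion (F G : sgraph) := Immersion {
  terminal : F -> G;
  route : {set F} -> seq G;
  terminal_inj : injective terminal;
  route_joins : forall u v : F, adj u v ->
    joins (terminal u) (terminal v) (route [set u; v]);
  route_disjoint : forall A B : {set F},
    A \in edges F -> B \in edges F -> A != B ->
    [disjoint path_edges (route A) & path_edges (route B)]
}.

Definition has_immersion (F G : sgraph) : Prop := inhabited (immersion F G).

Definition has_clique_immersion (G : sgraph) : pred nat :=
  fun t => `[< has_immersion (complete t) G >].

Lemma clique_immersion_ex (G : sgraph) : exists t, has_clique_immersion G t.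
Proof.
exists 0; apply/asboolP; constructor.
have K0 (x : complete 0) : False by case: x.
apply: (@Immersion _ _ (fun x => False_rect _ (K0 x)) (fun=> [::])).
- by move=> x; case: (K0 x).
- by move=> x; case: (K0 x).
- by move=> A B; rewrite inE => /existsP[x]; case: (K0 x).
Qed.

Lemma clique_immersion_le (G : sgraph) (t : nat) :
  has_clique_immersion G t -> t <= #|G|.
Proof.
move=> /asboolP[I]; have := max_card (mem (codom (terminal I))).
by rewrite (card_codom (@terminal_inj _ _ I)) card_ord.
Qed.

Definition im (G : sgraph) : nat :=
  ex_maxn (clique_immersion_ex G) (@clique_immersion_le G).

Definition all_even_pegs (F G : sgraph) (I : immersion F G) : Prop :=
  forall A, A \in edges F -> ~~ odd (size (pegs (route I A))).

Definition all_odd_pegs (F G : sgraph) (I : immersion F G) : Prop :=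
  forall A, A \in edges F -> odd (size (pegs (route I A))).

(* Main.v *)
(* An immersion of [F] in [G] is an injection of the vertices together with a
   colouring of the edges of [G] by those of [F] such that the class of [uv]
   connects the images of [u] and [v].  Colourings compose, so two facts suffice.

   First, [F1 x F2] immerses in [G1 x G2] when all routes of the two immersions
   have lengths of one parity.  For a route [P] of length [p] and a route [Q] of
   length [q >= p], go along [Q] while going along [P] and then bouncing on its
   last edge; reflecting the first coordinate gives the second diagonal of
   [P x Q].  The two walks never use the same edge, since an edge changes the
   first coordinate by one and so cannot have both ends on the axis of the
   reflection.

   Second, [K_(s m + 1)] immerses in [K_(s+1) x K_(m+1)].  The terminals are
   (0, 0) and the (i, j) with [i, j > 0].  Those in different rows and columns
   are adjacent.  The terminals (i, j) and (i, j') of a row are joined through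
   (0, f j j'), those of a column, (i, j) and (i', j), through (f i i', 0), with
   [f] a symmetric idempotent Latin square.  In even order no such [f] exists, but
   there is one whose symmetry fails only at antipodal pairs.  These are joined
   through the pegs of the other kind if [s] and [m] are both even, and by a path
   (i, j), (f i i', 0), (0, j), (f i' i, 0), (i', j) if only [s] is even. *)

Require Import Defs.
From mathcomp Require Import all_boot.
From mathcomp Require Import boolp ssralg zmodp perm zify.

Set Implicit Arguments.
Unset Strict Implicit.
Unset Printing Implicit Defensive.

Lemma eq_set2 (T : finType) (a b c d : T) :
  [set a; b] = [set c; d] -> (a = c /\ b = d) \/ (a = d /\ b = c).
Proof.
move=> E.
have: a \in [set c; d] by rewrite -E set21.
have: b \in [set c; d] by rewrite -E set22.
have: c \in [set a; b] by rewrite E set21.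
have: d \in [set a; b] by rewrite E set22.
by rewrite !inE; do 4![case/orP=> /eqP ?]; subst; auto.
Qed.

Lemma imset_set2 (T U : finType) (f : T -> U) (a b : T) :
  f @: [set a; b] = [set f a; f b].
Proof. by rewrite imsetU1 imset_set1. Qed.

Lemma exists_factor (I : finType) (T : eqType) (C : Type) (c0 : C)
    (P : {pred I}) (h : I -> T) (k : I -> C) :
  {in P &, forall i j, h i = h j -> k i = k j} ->
  exists c : T -> C, {in P, forall i, c (h i) = k i}.
Proof.
move=> hk; exists (fun y => if [pick i in P | h i == y] is Some i then k i else c0).
move=> i Pi; case: pickP => [j /andP[Pj /eqP hji]|/(_ i)]; first exact: hk.
by rewrite /= Pi eqxx.
Qed.

Lemma connect_homo (T U : finType) (e : rel T) (e' : rel U) (f : T -> U) :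
  {homo f : x y / e x y >-> connect e' x y} ->
  {homo f : x y / connect e x y >-> connect e' x y}.
Proof.
move=> ee' x _ /connectP[s + ->]; elim: s x => //= z s IHs x /andP[xz zs].
exact: connect_trans (ee' _ _ xz) (IHs _ zs).
Qed.

Lemma connect_nat (T : finType) (R : rel T) (w : nat -> T) (n : nat) :
  (forall i, i < n -> R (w i) (w i.+1)) -> connect R (w 0) (w n).
Proof.
elim: n => [|n IHn] Rw; first exact: connect0.
by apply: connect_trans (IHn _) (connect1 (Rw n _)) => // i /leqW/Rw.
Qed.

Lemma edgesP (G : sgraph) (A : {set G}) :
  reflect (exists x y, adj x y /\ A = [set x; y]) (A \in edges G).
Proof.
rewrite inE; apply: (iffP existsP) => -[x].
  by case/existsP=> y /andP[xy /eqP->]; exists x, y.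
by case=> y [xy ->]; exists x; apply/existsP; exists y; rewrite xy eqxx.
Qed.

Lemma mem_edges (G : sgraph) (x y : G) : adj x y -> [set x; y] \in edges G.
Proof. by move=> xy; apply/edgesP; exists x, y. Qed.

Lemma adj_neq (G : sgraph) (x y : G) : adj x y -> x != y.
Proof. by apply: contraTneq => ->; rewrite adj_irrefl. Qed.

Lemma path_edgesP (G : sgraph) (x0 : G) (s : seq G) (E : {set G}) :
  reflect (exists2 i, i.+1 < size s & E = [set nth x0 s i; nth x0 s i.+1])
    (E \in path_edges s).
Proof.
have size_steps : size (zip s (behead s)) = (size s).-1.
  by rewrite size_zip size_behead; lia.
have nth_steps i : i < (size s).-1 ->
    nth (x0, x0) (zip s (behead s)) i = (nth x0 s i, nth x0 s i.+1).
  by move=> lt_i; rewrite nth_zip_cond size_steps lt_i nth_behead.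
apply: (iffP imsetP) => [[p /(nthP (x0, x0))[i] + <- ->]|[i lt_i ->]].
  by rewrite size_steps => lt_i; exists i; rewrite ?nth_steps //; lia.
have {}lt_i : i < (size s).-1 by lia.
by exists (nth x0 s i, nth x0 s i.+1); rewrite // -nth_steps // mem_nth ?size_steps.
Qed.

Lemma is_path_nth (G : sgraph) (x y : G) (s : seq G) : is_path x y s ->
  [/\ 0 < size s, nth x s 0 = x, nth x s (size s).-1 = y, uniq s
    & forall i, i.+1 < size s -> adj (nth x s i) (nth x s i.+1)].
Proof.
case: s => //= z s /and4P[/eqP-> ps /eqP<- us]; split=> //.
  by rewrite -last_nth.
by move=> i lt_i; exact: (pathP x ps).
Qed.

Definition adj_in (G : sgraph) (X : {pred {set G}}) : rel G :=
  [rel a b | adj a b && ([set a; b] \in X)].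

Lemma adj_in_sym (G : sgraph) (X : {pred {set G}}) : symmetric (adj_in X).
Proof. by move=> a b; rewrite /adj_in /= adj_sym setUC. Qed.

Lemma connect_adj_inC (G : sgraph) (X : {pred {set G}}) (x y : G) :
  connect (adj_in X) x y = connect (adj_in X) y x.
Proof. exact: sym_connect_sym (adj_in_sym X) x y. Qed.

Lemma connect_adj_inS (G : sgraph) (X Y : {pred {set G}}) (x y : G) :
  {subset X <= Y} -> connect (adj_in X) x y -> connect (adj_in Y) x y.
Proof.
move=> XY; apply: connect_sub => a b /andP[ab abX].
by apply: connect1; rewrite /adj_in /= ab XY.
Qed.

Lemma adj_in_nth (G : sgraph) (x y : G) (s : seq G) (i : nat) :
  is_path x y s -> i.+1 < size s ->
  adj_in (path_edges s) (nth x s i) (nth x s i.+1).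
Proof.
case/is_path_nth=> _ _ _ _ adj_s lt_i; rewrite /adj_in /= adj_s //=.
by apply/path_edgesP; exists i.
Qed.

Lemma connect_adj_inP (G : sgraph) (X : {pred {set G}}) (x y : G) :
  reflect (exists s, is_path x y s /\ {subset path_edges s <= X})
    (connect (adj_in X) x y).
Proof.
apply: (iffP connectP) => [[s0 + ->]|[s [xys sX]]].
  case/shortenP=> s ps us _; exists (x :: s); split.
    by apply/and4P; split=> //; apply: sub_path ps => a b /andP[].
  by move=> E /(path_edgesP x)[i lt_i ->]; have /andP[] := pathP x ps i lt_i.
apply/connectP; apply: connect_adj_inS sX _.
have [_ s0 s_last _ _] := is_path_nth xys; rewrite -[X in connect _ X]s0 -s_last.
by apply: (connect_nat (w := nth x s)) => i lt_i; apply: adj_in_nth xys _; lia.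
Qed.

Section Immersion.
Variables (F G : sgraph) (I : immersion F G).

Lemma route_path (A : {set F}) : A \in edges F -> exists u v,
  [/\ adj u v, A = [set u; v] & is_path (terminal I u) (terminal I v) (route I A)].
Proof.
case/edgesP=> u [v [uv ->]]; case/orP: (route_joins I uv) => p; first by exists u, v.
by exists v, u; rewrite adj_sym [[set v; u]]setUC.
Qed.

Lemma route_connect (u v : F) : adj u v ->
  connect (adj_in (path_edges (route I [set u; v]))) (terminal I u) (terminal I v).
Proof.
move=> uv; case/orP: (route_joins I uv) => p; last rewrite connect_adj_inC;
  by apply/connect_adj_inP; exists (route I [set u; v]); split.
Qed.

Lemma exists_route_colouring : exists c : {set G} -> {set F}, forall A E,
  A \in edges F -> E \in path_edges (route I A) -> c E = A.
Proof.
pose on_route := [pred AE : {set F} * {set G} |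
  (AE.1 \in edges F) && (AE.2 \in path_edges (route I AE.1))].
have [|c cP] := @exists_factor _ _ _ set0 on_route snd fst; last first.
  by exists c => A E eA AE; apply: (cP (A, E)); rewrite inE eA.
move=> [A E] [B E'] /andP[/= eA AE] /andP[/= eB BE'] defE; subst E'.
apply/eqP; apply: contraLR BE' => AB.
by rewrite (disjointFr (route_disjoint I eA eB AB) AE).
Qed.

Lemma size_route (A : {set F}) : A \in edges F -> 1 < size (route I A).
Proof.
case/route_path=> u [v [uv ->]]; case: (route I _) => [|z [|z' s]] //.
case/and4P=> /eqP-> _ /eqP /(@terminal_inj _ _ I) vu _.
by move: (adj_neq uv); rewrite vu eqxx.
Qed.

End Immersion.

Lemma has_immersionP (F G : sgraph) :
  has_immersion F G <->
  exists (f : F -> G) (c : {set G} -> {set F}), injective f /\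
    forall u v, adj u v ->
      connect (adj_in [pred E | c E == [set u; v]]) (f u) (f v).
Proof.
split=> [[I]|[f [c [f_inj c_conn]]]].
  have [c cP] := exists_route_colouring I; exists (terminal I), c; split.
    exact: terminal_inj.
  move=> u v uv; apply: connect_adj_inS (route_connect I uv) => E EI.
  by rewrite inE (cP [set u; v]) ?mem_edges.
have /choice[rt rtP] (A : {set F}) : exists s, A \in edges F ->
    {subset path_edges s <= [pred E | c E == A]} /\
    exists u v, A = [set u; v] /\ is_path (f u) (f v) s.
  have [/edgesP[u [v [uv ->]]]|_] := boolP (A \in edges F); last by exists [::].
  have /connect_adj_inP[s [ps sc]] := c_conn _ _ uv.
  by exists s; split=> //; exists u, v.
constructor; apply: (@Immersion _ _ f rt f_inj).
  move=> u v uv; have [_ [u' [v' [E ps]]]] := rtP _ (mem_edges uv).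
  by rewrite /joins; case: (eq_set2 E) ps => -[-> ->] ->; rewrite ?orbT.
move=> A B /rtP[sA _] /rtP[sB _]; apply: contraR => /pred0Pn[E /andP[/= EA EB]].
by rewrite -(eqP (sA _ EA)) -(eqP (sB _ EB)).
Qed.

Lemma has_immersion_trans (F G H : sgraph) :
  has_immersion F G -> has_immersion G H -> has_immersion F H.
Proof.
move=> /has_immersionP[f [c [f_inj c_conn]]] /has_immersionP[g [d [g_inj d_conn]]].
apply/has_immersionP; exists (g \o f), (c \o d); split; first exact: inj_comp.
move=> u v /c_conn; apply: (connect_homo (f := g)) => a b /andP[ab /= /eqP cab].
by apply: connect_adj_inS (d_conn _ _ ab) => E /eqP dE; rewrite inE /= dE cab.
Qed.

Lemma has_immersion_hom (F G : sgraph) (f : F -> G) :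
  injective f -> {homo f : u v / adj u v} -> has_immersion F G.
Proof.
move=> f_inj f_hom; apply/has_immersionP.
exists f, (fun E : {set G} => f @^-1: E); split=> // u v uv.
apply: connect1; rewrite /adj_in /= f_hom //= inE; apply/eqP/setP => w.
by rewrite !inE !(inj_eq f_inj).
Qed.

(* The route from [u] to [v] leaves [u] through [g u v]. *)
Lemma has_immersion_of_spokes (F G : sgraph) (f : F -> G) (g : F -> F -> G)
    (c : {set G} -> {set F}) :
  injective f ->
  (forall u v, adj u v -> adj (f u) (g u v)) ->
  (forall u v v', adj u v -> adj u v' -> g u v = g u v' -> v = v') ->
  (forall u v w, adj u v -> g u v = f w -> w = v) ->
  (forall u v, adj u v -> g u v != f v ->
    connect (adj_in [pred E : {set G} |
      [disjoint E & codom f] && (c E == [set u; v])]) (g u v) (g v u)) ->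
  has_immersion F G.
Proof.
move=> f_inj g_adj g_inj g_f g_conn.
have [|d dP] := @exists_factor _ _ _ set0 [pred uv : F * F | adj uv.1 uv.2]
    (fun uv => [set f uv.1; g uv.1 uv.2]) (fun uv => [set uv.1; uv.2]).
  move=> [u v] [u' v']; rewrite !inE /= => uv uv' /eq_set2[] [].
    by move/f_inj=> uu'; subst u' => /(g_inj _ _ _ uv uv')->.
  by move=> /esym/(g_f _ _ _ uv') u_v' /(g_f _ _ _ uv)->; rewrite u_v' setUC.
apply/has_immersionP; exists f.
exists (fun E : {set G} => if [disjoint E & codom f] then c E else d E).
split=> // u v uv.
set X := [pred E | _].
have spoke a b : adj a b -> [set a; b] = [set u; v] -> connect (adj_in X) (f a) (g a b).
  move=> ab E; apply: connect1; rewrite /adj_in /= g_adj //= inE.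
  rewrite ifF ?(dP (a, b)) ?E //; apply/pred0P => /(_ (f a)).
  by rewrite /= set21 codom_f.
have [guv|guv] := eqVneq (g u v) (f v); first by rewrite -guv spoke.
apply: connect_trans (spoke _ _ uv erefl) (connect_trans (y := g v u) _ _).
  apply: connect_adj_inS (g_conn _ _ uv guv) => E /andP[dE cE].
  by rewrite inE dE.
by rewrite connect_adj_inC spoke 1?adj_sym // setUC.
Qed.

Lemma leq_im (G : sgraph) (n : nat) : has_immersion (complete n) G -> n <= im G.
Proof.
by move=> I; rewrite /im; case: ex_maxnP => m _; apply; apply/asboolP.
Qed.

Lemma im_gt0 (G : sgraph) : 0 < #|G| -> 0 < im G.
Proof.
case/card_gt0P=> x _; apply: leq_im; apply: (@has_immersion_hom _ _ (fun=> x)).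
  by move=> u v _; rewrite (ord1 u) (ord1 v).
by move=> u v; rewrite (ord1 u) (ord1 v) adj_irrefl.
Qed.

(** * Direct products of immersions *)

(* The position after [n] steps of a walk that goes from one end of a path of
   length [p] to the other and then bounces on the last edge. *)
Definition bounce (p n : nat) : nat := if n <= p then n else p - odd (n - p).

Lemma bounce_le p n : bounce p n <= p.
Proof. by rewrite /bounce; case: ifP => //; rewrite leq_subr. Qed.

Lemma bounce_end p n : p <= n -> odd p = odd n -> bounce p n = p.
Proof. by rewrite /bounce; case: ifP; lia. Qed.

Lemma bounceS p n : 0 < p ->
  bounce p n.+1 = (bounce p n).+1 \/ bounce p n = (bounce p n.+1).+1.
Proof. by rewrite /bounce; do 2!case: ifP; lia. Qed.

Definition product_edges (G H : sgraph) (P : seq G) (Q : seq H) :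
    {pred {set dprod G H}} :=
  [pred E : {set dprod G H} |
    (fst @: E \in path_edges P) && (snd @: E \in path_edges Q)].

Lemma adj_in_product_edges (G H : sgraph) (P : seq G) (Q : seq H)
    (Z : {pred {set dprod G H}}) (e e' : dprod G H) :
  adj_in [predI product_edges P Q & Z] e e' =
  [&& adj_in (path_edges P) e.1 e'.1, adj_in (path_edges Q) e.2 e'.2
    & [set e; e'] \in Z].
Proof.
rewrite /adj_in /= inE /= inE /= !imset_set2 /dprod_rel.
by case: (adj e.1 _); case: (adj e.2 _); case: (_ \in path_edges P); rewrite ?andbF.
Qed.

Definition splits_diagonals (G H : sgraph) (P : seq G) (Q : seq H)
    (a b : G) (x y : H) (S : {set dprod G H}) : Prop :=
  connect (adj_in [predI product_edges P Q & powerset S]) (a, x) (b, y) /\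
  connect (adj_in [predI product_edges P Q & [predC powerset S]]) (b, x) (a, y).

Section Zigzag.
Variables (G H : sgraph) (a b : G) (x y : H) (P : seq G) (Q : seq H).
Hypotheses (ab : a != b) (path_P : is_path a b P) (path_Q : is_path x y Q).
Hypotheses (odd_PQ : odd (size P) = odd (size Q)) (le_PQ : size P <= size Q).

Let p := (size P).-1.
Let q := (size Q).-1.

Definition zigzag : {set dprod G H} :=
  [set (nth a P (bounce p n), nth x Q n) | n : 'I_(size Q)].

Let size_P : size P = p.+1.
Proof. by rewrite prednK //; case: (is_path_nth path_P). Qed.

Let size_Q : size Q = q.+1.
Proof. by rewrite prednK //; case: (is_path_nth path_Q). Qed.

Let p_gt0 : 0 < p.
Proof.
have [_ Pa Pb _ _] := is_path_nth path_P; move: ab; rewrite -{1}Pa -{1}Pb -/p.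
by case: (p) => //; rewrite eqxx.
Qed.

Let bounce_pq : bounce p q = p.
Proof.
apply: bounce_end; first by rewrite -ltnS -size_P -size_Q.
by apply: negb_inj; rewrite -!oddS -size_P -size_Q.
Qed.

Lemma mem_zigzag k n : k <= p -> n <= q ->
  ((nth a P k, nth x Q n) \in zigzag) = (k == bounce p n).
Proof.
have [[_ _ _ uP _] [_ _ _ uQ _]] := (is_path_nth path_P, is_path_nth path_Q).
move=> le_k le_n; have lt_n : n < size Q by rewrite size_Q.
apply/imsetP/eqP => [[m _ [/eqP + /eqP]]|->]; last by exists (Ordinal lt_n).
rewrite nth_uniq ?size_P ?ltnS ?bounce_le // => /eqP->.
by rewrite nth_uniq // => /eqP->.
Qed.

Lemma adj_in_consecutive (Z : {pred {set dprod G H}}) i j n :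
  i <= p -> j <= p -> j = i.+1 \/ i = j.+1 -> n < q ->
  [set (nth a P i, nth x Q n); (nth a P j, nth x Q n.+1)] \in Z ->
  adj_in [predI product_edges P Q & Z]
    (nth a P i, nth x Q n) (nth a P j, nth x Q n.+1).
Proof.
move=> le_i le_j ij lt_n eZ; rewrite adj_in_product_edges eZ andbT /=.
rewrite (adj_in_nth path_Q) ?size_Q // andbT.
by case: ij => [def_j|def_i]; last rewrite adj_in_sym; rewrite ?def_j ?def_i;
  apply: adj_in_nth path_P _; rewrite size_P; lia.
Qed.

Lemma connect_zigzag :
  connect (adj_in [predI product_edges P Q & powerset zigzag]) (a, x) (b, y).
Proof.
have [[_ Pa Pb _ _] [_ Qx Qy _ _]] := (is_path_nth path_P, is_path_nth path_Q).
pose w n : dprod G H := (nth a P (bounce p n), nth x Q n).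
have -> : (a, x) = w 0 by rewrite /w Pa Qx.
have -> : (b, y) = w q by rewrite /w bounce_pq Pb Qy.
apply: connect_nat => n lt_n; apply: adj_in_consecutive; rewrite ?bounce_le //.
  exact: bounceS p_gt0.
by rewrite powersetE subUset !sub1set !mem_zigzag ?bounce_le ?eqxx // ltnW.
Qed.

Lemma connect_reflected_zigzag :
  connect (adj_in [predI product_edges P Q & [predC powerset zigzag]])
    (b, x) (a, y).
Proof.
have [[_ Pa Pb _ _] [_ Qx Qy _ _]] := (is_path_nth path_P, is_path_nth path_Q).
pose w n : dprod G H := (nth a P (p - bounce p n), nth x Q n).
have -> : (b, x) = w 0 by rewrite /w subn0 Pb Qx.
have -> : (a, y) = w q by rewrite /w bounce_pq subnn Pa Qy.
apply: connect_nat => n lt_n; have bounce_step := bounceS n p_gt0.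
have [le_bounce le_bounceS] := (bounce_le p n, bounce_le p n.+1).
apply: adj_in_consecutive; rewrite ?leq_subr //; first by lia.
rewrite !inE subUset !sub1set !mem_zigzag ?leq_subr //; last exact: ltnW.
by lia.
Qed.

Lemma zigzag_splits_diagonals : splits_diagonals P Q a b x y zigzag.
Proof. by split; [exact: connect_zigzag | exact: connect_reflected_zigzag]. Qed.

End Zigzag.

Lemma splits_diagonals_swap (G H : sgraph) (a b : G) (x y : H) (P : seq G)
    (Q : seq H) (S : {set dprod H G}) :
  splits_diagonals Q P x y a b S ->
  splits_diagonals P Q a b x y [set e | (e.2, e.1) \in S].
Proof.
move=> [conn_S conn_SC]; pose swap (e : dprod H G) : dprod G H := (e.2, e.1).
set S' := [set e | _].
have swap_conn (Z : {pred {set dprod H G}}) (Z' : {pred {set dprod G H}}) :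
    (forall e e', ([set swap e; swap e'] \in Z') = ([set e; e'] \in Z)) ->
    {homo swap : e e' / connect (adj_in [predI product_edges Q P & Z]) e e'
      >-> connect (adj_in [predI product_edges P Q & Z']) e e'}.
  move=> ZZ'; apply: connect_homo => e e'; rewrite adj_in_product_edges.
  case/and3P=> eQ eP eZ; apply: connect1.
  by rewrite adj_in_product_edges ZZ' eZ eP eQ.
have swap_sub e e' : ([set swap e; swap e'] \subset S') = ([set e; e'] \subset S).
  by rewrite !subUset !sub1set !inE -!surjective_pairing.
split; first by apply: swap_conn conn_S => e e'; rewrite !inE swap_sub.
rewrite connect_adj_inC; apply: swap_conn conn_SC => e e'.
by rewrite !inE swap_sub.
Qed.

Lemma exists_splits_diagonals (G H : sgraph) (a b : G) (x y : H) (P : seq G)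
    (Q : seq H) :
  a != b -> x != y -> is_path a b P -> is_path x y Q ->
  odd (size P) = odd (size Q) -> exists S, splits_diagonals P Q a b x y S.
Proof.
move=> ab xy path_P path_Q odd_PQ.
have [le_PQ|/ltnW le_QP] := leqP (size P) (size Q).
  by exists (zigzag a x P Q); apply: zigzag_splits_diagonals.
exists [set e | (e.2, e.1) \in zigzag x a Q P].
by apply/splits_diagonals_swap/zigzag_splits_diagonals.
Qed.

Section Product.
Variables (F1 F2 G1 G2 : sgraph) (I1 : immersion F1 G1) (I2 : immersion F2 G2).

Let f (u : dprod F1 F2) : dprod G1 G2 := (terminal I1 u.1, terminal I2 u.2).

Lemma diagonal_colouring (A : {set F1}) (B : {set F2}) :
  A \in edges F1 -> B \in edges F2 ->
  odd (size (route I1 A)) = odd (size (route I2 B)) ->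
  exists c : {set dprod G1 G2} -> {set dprod F1 F2}, forall u v : dprod F1 F2,
    A = [set u.1; v.1] -> B = [set u.2; v.2] ->
    connect (adj_in [predI product_edges (route I1 A) (route I2 B)
      & [pred E | c E == [set u; v]]]) (f u) (f v).
Proof.
move=> /(route_path I1)[a [b [/adj_neq ab -> path_A]]].
move=> /(route_path I2)[x [y [/adj_neq xy -> path_B]]] odd_AB.
have [||S [conn_S conn_SC]] := exists_splits_diagonals _ _ path_A path_B odd_AB.
- by rewrite (inj_eq (@terminal_inj _ _ I1)).
- by rewrite (inj_eq (@terminal_inj _ _ I2)).
set X := product_edges _ _ in conn_S conn_SC *.
pose D1 : {set dprod F1 F2} := [set (a, x); (b, y)].
pose D2 : {set dprod F1 F2} := [set (b, x); (a, y)].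
pose c (E : {set dprod G1 G2}) := if E \in powerset S then D1 else D2; exists c.
have conn_D1 : connect (adj_in [predI X & [pred E | c E == D1]]) (f (a, x)) (f (b, y)).
  apply: connect_adj_inS conn_S => E /andP[/= XE SE].
  by apply/andP; split; rewrite // inE /c SE.
have conn_D2 : connect (adj_in [predI X & [pred E | c E == D2]]) (f (b, x)) (f (a, y)).
  apply: connect_adj_inS conn_SC => E /andP[/= XE /negPf SE].
  by apply/andP; split; rewrite // inE /c SE.
move=> [a' x'] [b' y'] /= /eq_set2[] [<- <-] /eq_set2[] [<- <-] //.
- by rewrite (@connect_adj_inC (dprod G1 G2)) [[set (a, y); _]]setUC.
- by rewrite (@connect_adj_inC (dprod G1 G2)) [[set (b, y); _]]setUC.
Qed.

Lemma has_immersion_dprod :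
  (forall A B, A \in edges F1 -> B \in edges F2 ->
    odd (size (route I1 A)) = odd (size (route I2 B))) ->
  has_immersion (dprod F1 F2) (dprod G1 G2).
Proof.
move=> same_odd; have [c1 c1P] := exists_route_colouring I1.
have [c2 c2P] := exists_route_colouring I2.
have /choice[d dP] (AB : {set F1} * {set F2}) :
    exists c : {set dprod G1 G2} -> {set dprod F1 F2},
    AB.1 \in edges F1 -> AB.2 \in edges F2 ->
    forall u v : dprod F1 F2, AB.1 = [set u.1; v.1] -> AB.2 = [set u.2; v.2] ->
    connect (adj_in [predI product_edges (route I1 AB.1) (route I2 AB.2)
      & [pred E | c E == [set u; v]]]) (f u) (f v).
  case: AB => A B /=.
  have [eA|] := boolP (A \in edges F1); last by exists (fun=> set0).
  have [eB|] := boolP (B \in edges F2); last by exists (fun=> set0).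
  by have [c cP] := diagonal_colouring eA eB (same_odd _ _ eA eB); exists c.
apply/has_immersionP; exists f.
exists (fun E : {set dprod G1 G2} => d (c1 (fst @: E), c2 (snd @: E)) E); split.
  by move=> [a x] [b y] [/(@terminal_inj _ _ I1)-> /(@terminal_inj _ _ I2)->].
move=> u v /andP[/mem_edges eA /mem_edges eB].
apply: connect_adj_inS (dP (_, _) eA eB u v erefl erefl) => E /andP[/andP[/= EA EB] Ec].
by rewrite inE (c1P _ _ eA EA) (c2P _ _ eB EB).
Qed.

End Product.

Lemma odd_size_pegs (G : sgraph) (s : seq G) :
  1 < size s -> odd (size (pegs s)) = odd (size s).
Proof. by case: s => [|x [|y s]] //= _; rewrite size_belast negbK. Qed.

Lemma has_immersion_dprod_pegs (F1 F2 G1 G2 : sgraph)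
    (I1 : immersion F1 G1) (I2 : immersion F2 G2) :
  (all_even_pegs I1 /\ all_even_pegs I2) \/ (all_odd_pegs I1 /\ all_odd_pegs I2) ->
  has_immersion (dprod F1 F2) (dprod G1 G2).
Proof.
move=> same; apply: (@has_immersion_dprod _ _ _ _ I1 I2) => A B eA eB.
rewrite -(odd_size_pegs (size_route I1 eA)) -(odd_size_pegs (size_route I2 eB)).
by case: same => -[/(_ A eA) + /(_ B eB)]; do 2!case: (odd _).
Qed.

(** * Near-symmetric idempotent Latin squares *)

Definition matched_square (S : Type) (f : S -> S -> S) (p : S -> S) : Prop :=
  [/\ involutive p, forall i, f i i = i, forall i, injective (f i),
      forall i j, j <> p i -> f i j = f j i
    & injective (fun i => f i (p i))].

(* The midpoint of the shorter arc from [0] to [d] if its length is even, and a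
   neighbour of the antipode of that midpoint if the length is odd. *)
Definition near_half (h d : nat) : nat :=
  uphalf d + (if d == h then 0 else if odd d (+) (h < d) then h else 0).

Lemma near_half_bound h d : d < h.*2 -> near_half h d < h.*2.
Proof. by rewrite /near_half; do 2?case: ifP; lia. Qed.

Lemma near_half_inj h : {in gtn h.*2 &, injective (near_half h)}.
Proof. by move=> d d'; rewrite /near_half !inE; do 4?case: ifP; lia. Qed.

Lemma near_half_opp h d : 0 < d < h.*2 -> d <> h ->
  near_half h d = d + near_half h (h.*2 - d) \/
  near_half h d + h.*2 = d + near_half h (h.*2 - d).
Proof. by rewrite /near_half; do 4?case: ifP; lia. Qed.

Section CyclicSquare.
Import GRing.Theory.
Local Open Scope ring_scope.

Lemma zmod_matched_square (V : zmodType) (z : V) (o : V -> V) :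
  z + z = 0 -> o 0 = 0 -> injective o ->
  (forall d, d <> z -> o d = d + o (- d)) ->
  matched_square (fun i j => i + o (j - i)) (fun i => i + z).
Proof.
move=> zz o0 o_inj oN; split.
- by move=> i; rewrite -addrA zz addr0.
- by move=> i; rewrite subrr o0 addr0.
- by move=> i j j' /addrI/o_inj/addIr.
- move=> i j ijz; rewrite oN ?opprB; last first.
    by move=> defz; apply: ijz; rewrite -defz addrC subrK.
  by rewrite addrA (addrC i) subrK.
- by move=> i j; rewrite ![_ + z]addrC !addrK => /addIr.
Qed.

Lemma midpoint_matched_square (V : zmodType) (k : nat) :
  (forall d : V, d *+ k.*2 = d) ->
  matched_square (fun i j : V => i + (j - i) *+ k) id.
Proof.
move=> dbl; have half_double (d : V) : d *+ k + d *+ k = d.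
  by rewrite -mulrnDr addnn dbl.
have [||||_ f_diag f_inj fC _] := @zmod_matched_square V 0 (fun d => d *+ k).
- exact: addr0.
- exact: mul0rn.
- by move=> d d' dd'; rewrite -[d]half_double dd' half_double.
- by move=> d _; rewrite -{2}[d]half_double mulNrn addrK.
split=> // [i j ij|i j]; first by apply: fC; rewrite addr0.
by rewrite !subrr mul0rn !addr0.
Qed.

Lemma odd_matched_square (n : nat) : ~~ odd n ->
  exists f, matched_square f (id : 'I_n.+1 -> 'I_n.+1).
Proof.
move=> even_n; exists (fun i j => i + (j - i) *+ n./2.+1).
apply: midpoint_matched_square => d; rewrite Zp_mulrn -[RHS]valZpK.
have -> : (n./2.+1.*2 = n.+2)%N by lia.
by apply: ord_inj; rewrite /= mulnS addnC modnMDl.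
Qed.

Lemma even_matched_square (n : nat) : odd n ->
  exists f p, matched_square f p /\ forall i : 'I_n.+1, p i != i.
Proof.
move=> odd_n; pose h := n.+1./2; have hh : h.*2 = n.+1 by rewrite /h; lia.
pose z : 'I_n.+1 := inZp h.
pose o (d : 'I_n.+1) : 'I_n.+1 := inZp (near_half h d).
have bound (d : 'I_n.+1) : (near_half h d < n.+1)%N.
  by have := @near_half_bound h d; rewrite hh ltn_ord; apply.
have val_o d : o d = near_half h d :> nat by rewrite /= modn_small.
have val_z : z = h :> nat by rewrite /= modn_small //; lia.
exists (fun i j => i + o (j - i)), (fun i => i + z); split; last first.
  move=> i; apply/eqP => /(canRL (addKr i)); rewrite addNr => /(congr1 (@nat_of_ord _)).
  by rewrite val_z /=; lia.
apply: zmod_matched_square.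
- by apply: ord_inj; rewrite /= modnDm addnn hh modnn.
- by apply: ord_inj; rewrite val_o /near_half /=; case: ifP; lia.
- move=> d d' /(congr1 (@nat_of_ord _)); rewrite !val_o => /near_half_inj dd'.
  by apply: ord_inj; apply: dd'; rewrite inE hh ltn_ord.
- move=> d dz; apply: ord_inj.
  have d_neq_h : d <> h :> nat by rewrite -val_z => /ord_inj.
  have [->|d_neq0] := eqVneq d 0; first by rewrite oppr0 add0r.
  have d_gt0 : (0 < d)%N by rewrite lt0n; exact: d_neq0.
  have val_opp : nat_of_ord (- d) = (n.+1 - d)%N by rewrite /= modn_small; lia.
  have -> : nat_of_ord (d + o (- d)) = ((d + o (- d)%R) %% n.+1)%N by [].
  rewrite !val_o val_opp -(modn_small (bound d)) -[LHS]modnDr.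
  have := @near_half_opp h d; rewrite hh d_gt0 ltn_ord => /(_ isT d_neq_h) [->|->] //.
  by rewrite modnDr.
Qed.

Lemma exists_matched_square (n : nat) :
  exists f p, matched_square f p /\ forall i : 'I_n, (p i == i) = odd n.
Proof.
case: n => [|n].
  by exists (fun i _ => i), id; split=> [|[]//]; split=> -[].
have [odd_n|even_n] := boolP (odd n).
  have [f [p [sq p_free]]] := even_matched_square odd_n.
  by exists f, p; split=> // i; rewrite /= odd_n (negPf (p_free i)).
have [f sq] := odd_matched_square even_n.
by exists f, id; split=> // i; rewrite eqxx /= even_n.
Qed.

End CyclicSquare.

(** * Cliques in products of cliques *)

Section Clique.
Variable T : finType.
Definition clique_rel : rel T := fun x y => x != y.
Lemma clique_sym : symmetric clique_rel.
Proof. by move=> x y; rewrite /clique_rel eq_sym. Qed.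
Lemma clique_irrefl : irreflexive clique_rel.
Proof. by move=> x; rewrite /clique_rel eqxx. Qed.
Definition clique : sgraph := SGraph clique_sym clique_irrefl.
End Clique.

Section CliqueProduct.
Variables S M : finType.
Variables (fS : S -> S -> S) (pS : S -> S) (fM : M -> M -> M) (pM : M -> M).
Hypotheses (sqS : matched_square fS pS) (sqM : matched_square fM pM).

Let T := clique (option (S * M)).
Let L := dprod (clique (option S)) (clique (option M)).

Definition cell (u : T) : L := (omap fst u, omap snd u).

Definition row_mate (u : T) : T := omap (fun ij => (ij.1, pM ij.2)) u.

Definition column_mate (u : T) : T := omap (fun ij => (pS ij.1, ij.2)) u.

Definition row_peg (j : M) : L := (None, Some j).

Definition column_peg (i : S) : L := (Some i, None).

Definition peg (u v : T) : L :=
  match u, v with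
  | Some (i, j), Some (i', j') =>
    if i == i' then row_peg (fM j j')
    else if j == j' then column_peg (fS i i') else cell v
  | _, _ => cell v
  end.

Lemma cell_inj : injective cell.
Proof. by move=> [[i j]|] [[i' j']|] //= [-> ->]. Qed.

Lemma row_mateK : involutive row_mate.
Proof. by case: sqM => pMK _ _ _ _ [[i j]|] //=; rewrite pMK. Qed.

Lemma column_mateK : involutive column_mate.
Proof. by case: sqS => pSK _ _ _ _ [[i j]|] //=; rewrite pSK. Qed.

Lemma peg_cell u v w : peg u v = cell w -> w = v.
Proof.
case: u v w => [[i j]|] [[i' j']|] [[k l]|] //=; do 2?case: ifP => // _.
all: by case=> -> ->.
Qed.

Lemma peg_adj u v : u != v -> adj (cell u) (peg u v).
Proof.
case: sqS sqM => _ fSS fS_inj _ _ [_ fMM fM_inj _ _].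
case: u v => [[i j]|] [[i' j']|] //=.
rewrite /dprod_rel /= /clique_rel (inj_eq Some_inj) xpair_eqE.
have [_|ii'] := eqVneq i i'; rewrite /= => jj'.
  by rewrite (inj_eq Some_inj) -{1}[j]fMM (inj_eq (fM_inj j)).
have [ejj'|njj'] := eqVneq j j'; rewrite /= (inj_eq Some_inj) ?ii' ?njj' //=.
by rewrite -{1}[i]fSS (inj_eq (fS_inj i)) ii'.
Qed.

Lemma peg_inj u : injective (peg u).
Proof.
case: sqS sqM => _ _ fS_inj _ _ [_ _ fM_inj _ _].
case: u => [[i j]|]; last exact: cell_inj.
case=> [[i1 j1]|] [[i2 j2]|] //=; try by do 2?case: ifP.
case: (eqVneq i i1) => [<-|_]; case: (eqVneq i i2) => [<-|_];
  case: (eqVneq j j1) => [<-|_]; case: (eqVneq j j2) => [<-|_] // [] //.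
all: by do ?[move/fM_inj-> | move/fS_inj-> | move=> ->].
Qed.

Lemma peg_sym u v : v <> row_mate u -> v <> column_mate u ->
  peg u v != cell v -> peg u v = peg v u.
Proof.
case: sqS sqM => _ _ _ fSC _ [_ _ _ fMC _].
case: u v => [[i j]|] [[i' j']|] //=; rewrite ?eqxx // [i' == i]eq_sym [j' == j]eq_sym.
have [<- n_row _ _|_] := eqVneq i i'.
  by rewrite fMC // => def_j'; case: n_row; rewrite def_j'.
have [<- _ n_col _|_ _ _ /eqP //] := eqVneq j j'.
by rewrite fSC // => def_i'; case: n_col; rewrite def_i'.
Qed.

Lemma peg_row_mate i j :
  peg (Some (i, j)) (row_mate (Some (i, j))) = row_peg (fM j (pM j)).
Proof. by rewrite /= eqxx. Qed.

Lemma peg_column_mate i j : pS i != i ->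
  peg (Some (i, j)) (column_mate (Some (i, j))) = column_peg (fS i (pS i)).
Proof. by rewrite /= eq_sym => /negPf->; rewrite eqxx. Qed.

(* A row pair of mates borrows the peg of the column pair, and conversely. *)
Definition mate_swap (u : T) : {perm T} := tperm (row_mate u) (column_mate u).

Lemma has_immersion_clique_dprod_swap :
  (forall i, pS i != i) -> (forall j, pM j != j) -> has_immersion T L.
Proof.
move=> pS_free pM_free.
have swap_self u : mate_swap u u = u.
  case: u => [[i j]|]; last exact: tpermL.
  rewrite /mate_swap tpermD //= (inj_eq Some_inj) xpair_eqE.
    by rewrite (negPf (pM_free j)) andbF.
  by rewrite (negPf (pS_free i)).
have swap_None v : mate_swap None v = v by rewrite /mate_swap tperm1 perm1.
apply: (@has_immersion_of_spokes T L cell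
  (fun u v => peg u (mate_swap u v)) (fun=> set0)).
- exact: cell_inj.
- by move=> u v uv; rewrite peg_adj // -{1}[u]swap_self (inj_eq perm_inj).
- by move=> u v v' _ _ /peg_inj/perm_inj.
- move=> [[i j]|] v w _; last by rewrite swap_None => /peg_cell.
  rewrite /mate_swap; case: tpermP => [_|_|_ _]; last exact: peg_cell.
    by rewrite peg_column_mate //; case: w => [[]|].
  by rewrite peg_row_mate; case: w => [[]|].
- move=> [[i j]|] v; last by rewrite swap_None eqxx.
  move=> _ guv; apply: eq_connect0; move: guv; rewrite /mate_swap.
  case: tpermP => [-> _|-> _|v_row v_column guv].
  + by rewrite row_mateK tpermL !peg_column_mate.
  + by rewrite column_mateK tpermR peg_row_mate; exact/esym/peg_row_mate.
  + rewrite tpermD; first exact: peg_sym.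
      by apply/eqP => def_u; case: v_row; rewrite -def_u row_mateK.
    by apply/eqP => def_u; case: v_column; rewrite -def_u column_mateK.
Qed.

Lemma exists_detour_colouring : exists c : {set L} -> {set T}, forall i j,
  c [set column_peg (fS i (pS i)); row_peg j] =
  [set Some (i, j); column_mate (Some (i, j))].
Proof.
have [_ _ _ _ diag_inj] := sqS.
have [|c cP] := @exists_factor _ _ _ set0 predT
    (fun ij : S * M => [set column_peg (fS ij.1 (pS ij.1)); row_peg ij.2])
    (fun ij => [set (Some ij : T); column_mate (Some ij)]).
  by move=> [i j] [i' j'] _ _ /eq_set2[] [] // [/diag_inj->] [->].
by exists c => i j; exact: (cP (i, j)).
Qed.

Lemma has_immersion_clique_dprod_detour : pM =1 id -> has_immersion T L.
Proof.
move=> pM_id; have row_mate_id u : row_mate u = u.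
  by case: u => [[i j]|] //=; rewrite pM_id.
have [[pSK _ _ _ _] [c c_detour]] := (sqS, exists_detour_colouring).
pose X A := [pred E : {set L} | [disjoint E & codom cell] && (c E == A)].
have half_detour i j : connect (adj_in (X [set Some (i, j); column_mate (Some (i, j))]))
    (column_peg (fS i (pS i))) (row_peg j).
  apply: connect1; apply/andP; split=> //; rewrite inE c_detour eqxx andbT.
  apply/pred0P => -[k l]; apply/andP=> -[/= kl /codomP[[w|] def_kl]];
    by move: kl; rewrite def_kl !inE => /orP[] /eqP[].
apply: (@has_immersion_of_spokes T L cell peg c).
- exact: cell_inj.
- exact: peg_adj.
- by move=> u v v' _ _ /peg_inj.
- by move=> u v w _ /peg_cell.
- move=> u v uv guv; have [def_v|v_column] := eqVneq v (column_mate u); last first.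
    apply: eq_connect0; apply: peg_sym => //; last exact/eqP.
    by move=> def_v; move: uv; rewrite def_v row_mate_id adj_irrefl.
  rewrite -/(X _); subst v; case: u uv guv => [[i j]|]; last by rewrite adj_irrefl.
  have [pS_i|pS_i _ _] := eqVneq (pS i) i.
    by rewrite [column_mate _]/= pS_i adj_irrefl.
  have peg_back :
      peg (column_mate (Some (i, j))) (Some (i, j)) = column_peg (fS (pS i) i).
    by rewrite /= (negPf pS_i) eqxx.
  rewrite peg_column_mate // peg_back.
  apply: connect_trans (half_detour i j) _; rewrite connect_adj_inC.
  by have := half_detour (pS i) j; rewrite /= pSK setUC.
Qed.

End CliqueProduct.

Lemma has_immersion_clique (T U : finType) (f : T -> U) :
  injective f -> has_immersion (clique T) (clique U).
Proof.
move=> f_inj; apply: (@has_immersion_hom (clique T) (clique U) f) => // x y.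
by rewrite /= /clique_rel (inj_eq f_inj).
Qed.

Lemma has_immersion_dprodC (G H : sgraph) : has_immersion (dprod G H) (dprod H G).
Proof.
apply: (@has_immersion_hom (dprod G H) (dprod H G) (fun u => (u.2, u.1))).
  by move=> [a b] [a' b'] [-> ->].
by move=> u v /andP[uv1 uv2]; apply/andP.
Qed.

Lemma has_immersion_clique_dprod_ord (s m : nat) :
  has_immersion (clique (option ('I_s * 'I_m)))
    (dprod (clique (option 'I_s)) (clique (option 'I_m))).
Proof.
have [fS [pS [sqS pS_fixed]]] := exists_matched_square s.
have [fM [pM [sqM pM_fixed]]] := exists_matched_square m.
have [odd_m|even_m] := boolP (odd m).
  apply: has_immersion_clique_dprod_detour sqS sqM _ => j.
  by apply/eqP; rewrite pM_fixed.
have [odd_s|even_s] := boolP (odd s); last first.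
  by apply: (has_immersion_clique_dprod_swap sqS sqM) => i;
    rewrite ?pS_fixed ?pM_fixed.
pose swap (u : option ('I_s * 'I_m)) := omap (fun ij => (ij.2, ij.1)) u.
apply: has_immersion_trans (has_immersion_trans _ (has_immersion_dprodC _ _)).
  by apply: (@has_immersion_clique _ _ swap) => -[[i j]|] [[i' j']|] //= [-> ->].
apply: has_immersion_clique_dprod_detour sqM sqS _ => i.
by apply/eqP; rewrite pS_fixed.
Qed.

Lemma has_immersion_complete_dprod (s m : nat) :
  has_immersion (complete (s * m).+1) (dprod (complete s.+1) (complete m.+1)).
Proof.
have cardT : #|{: option ('I_s * 'I_m)}| = (s * m).+1.
  by rewrite card_option card_prod !card_ord.
have cardO n : #|{: option 'I_n}| = n.+1 by rewrite card_option card_ord.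
apply: (@has_immersion_trans _ (clique (option ('I_s * 'I_m)))).
  rewrite -cardT; apply: (@has_immersion_hom (complete _) (clique _) enum_val).
    exact: enum_val_inj.
  by move=> i j; rewrite /= /clique_rel (inj_eq enum_val_inj).
apply: has_immersion_trans (has_immersion_clique_dprod_ord s m) _.
rewrite -!cardO.
apply: (@has_immersion_hom (dprod (clique _) (clique _))
  (dprod (complete _) (complete _)) (fun u => (enum_rank u.1, enum_rank u.2))).
  by move=> [a b] [a' b'] [/enum_rank_inj-> /enum_rank_inj->].
move=> [a b] [a' b']; rewrite /= /dprod_rel /= /complete_rel.
by rewrite !(inj_eq enum_rank_inj).
Qed.

Theorem theorem23 (G H : sgraph) (t r : nat)
  (G_nonempty : 0 < #|G|) (H_nonempty : 0 < #|H|)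
  (imG : im G = t) (imH : im H = r)
  (I1 : immersion (complete t) G) (I2 : immersion (complete r) H)
  (same_parity : (all_even_pegs I1 /\ all_even_pegs I2) \/
                 (all_odd_pegs I1 /\ all_odd_pegs I2)) :
  (t - 1) * (r - 1) + 1 <= im (dprod G H).
Proof.
have t_gt0 : 0 < t by rewrite -imG im_gt0.
have r_gt0 : 0 < r by rewrite -imH im_gt0.
apply: leq_im; apply: has_immersion_trans (has_immersion_dprod_pegs same_parity).
have := has_immersion_complete_dprod (t - 1) (r - 1).
by rewrite !subn1 !prednK // addn1.
Qed.
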